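(* Consider the discrete constrained Wasserstein-Fisher-Rao problem $$\min_{(U,V)\in\mathcal{E}_s\times\mathcal{E}_c}\ J(V)+\iota_{\mathcal{CE}}(U)+\iota_{\{V=I(U)\}}(U,V)+\sum_{i=1}^d\iota_{\mathcal{C}_i}(V)$$ defined in the context. If its feasible set is nonempty, i.e. there exists $(U,V)\in\mathcal{E}_s\times\mathcal{E}_c$ with $U\in\mathcal{CE}$, $V=I(U)$, $V\in\bigcap_{i=1}^d\mathcal{C}_i$ and $J(V)<+\infty$, then the problem has a minimizer. Moreover, the nonemptiness of the feasible set can be checked by solving a second-order cone feasibility problem: there is a second-order cone feasibility problem, in the variables $(U,V)$ and finitely many auxiliary real variables and with coefficients given explicitly in terms of the data of the discrete problem, which is solvable if and only if the feasible set is nonempty.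
   Context: Data: $\delta>0$, $L>0$, positive integers $N_0,N_1$ (numbers of time and space steps), $h_0=1/N_0$, $h_1=L/N_1$, vectors $\rho_0,\rho_1\in\mathbb{R}^{N_1}$ (initial and final discrete densities), an integer $d\ge 0$, and for $i=1,\dots,d$ arrays $H_i^\rho,H_i^\omega,H_i^\zeta\in\mathbb{R}^{N_0\times N_1}$ and bounds $\ell_i,u_i\in\overline{\mathbb{R}}^{N_0}$ (extended real entries) with $\ell_i\le u_i$ componentwise. Variables. Centered variables are $V=(\rho,\omega,\zeta)\in\mathcal{E}_c$, three real arrays each indexed by $(j_0,j_1)$ with $0\le j_0\le N_0-1$, $0\le j_1\le N_1-1$ (the centered grid $\mathcal{G}_c$). Staggered variables are $U=(\bar\rho,\bar\omega,\bar\zeta)\in\mathcal{E}_s$, where $\bar\rho$ is indexed by $0\le j_0\le N_0$, $0\le j_1\le N_1-1$; $\bar\omega$ is indexed by $0\le j_0\le N_0-1$, $0\le j_1\le N_1$; and $\bar\zeta$ is indexed by $\mathcal{G}_c$. Interpolation: $I(U)=(I_\rho\bar\rho,I_\omega\bar\omega,\bar\zeta)\in\mathcal{E}_c$ with $(I_\rho\bar\rho)_{j_0,j_1}=\frac12(\bar\rho_{j_0,j_1}+\bar\rho_{j_0+1,j_1})$ and $(I_\omega\bar\omega)_{j_0,j_1}=\frac12(\bar\omega_{j_0,j_1}+\bar\omega_{j_0,j_1+1})$. Discrete continuity equation with boundary conditions: $\mathcal{CE}$ is the set of $U\in\mathcal{E}_s$ such that, for all $(j_0,j_1)\in\mathcal{G}_c$,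 $$\frac{\bar\rho_{j_0+1,j_1}-\bar\rho_{j_0,j_1}}{h_0}+\frac{\bar\omega_{j_0,j_1+1}-\bar\omega_{j_0,j_1}}{h_1}=\bar\zeta_{j_0,j_1},$$ and such that $\bar\rho_{0,j_1}=(\rho_0)_{j_1}$, $\bar\rho_{N_0,j_1}=(\rho_1)_{j_1}$ for all $0\le j_1\le N_1-1$, and $\bar\omega_{j_0,0}=\bar\omega_{j_0,N_1}=0$ for all $0\le j_0\le N_0-1$. Cost: $J(V)=\sum_{j\in\mathcal{G}_c}f_\delta(\rho_j,\omega_j,\zeta_j)\,h_0h_1$, where $f_\delta(r,w,z)=\frac{w^2+\delta^2z^2}{2r}$ if $r>0$, $f_\delta(0,0,0)=0$, and $f_\delta=+\infty$ otherwise. Box constraints: $\mathcal{C}_i$ is the set of $V\in\mathcal{E}_c$ such that for all $0\le j_0\le N_0-1$, $$\ell_{i,j_0}\le\sum_{j_1=0}^{N_1-1}\big((H_i^\rho)_{j_0,j_1}\rho_{j_0,j_1}+(H_i^\omega)_{j_0,j_1}\omega_{j_0,j_1}+(H_i^\zeta)_{j_0,j_1}\zeta_{j_0,j_1}\big)h_1\le u_{i,j_0}.$$ $\iota_S$ denotes the convex indicator function of a set $S$ ($0$ on $S$, $+\infty$ off $S$); $\{V=I(U)\}$ is the set of pairs $(U,V)$ with $V=I(U)$. A second-order cone feasibility problem asks whether there exists $x\in\mathbb{R}^m$ satisfying a finite system of affine equalities, affine inequalities, and second-order cone constraints of the form $\|Ax+b\|_2\le c^\top x+e$. *)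

(* Defs.v *)
From HB Require Import structures.
From mathcomp Require Import all_boot all_order all_algebra.
From mathcomp Require Import all_classical all_reals all_analysis.

Set Implicit Arguments.
Unset Strict Implicit.
Unset Printing Implicit Defensive.

Import Order.TTheory GRing.Theory Num.Theory.

Local Open Scope classical_set_scope.
Local Open Scope ring_scope.

(* Boxes are indexed by 'I_d, i.e. by 0, ..., d - 1 instead of 1, ..., d. *)
Record wfr_data (R : realType) (N0 N1 d : nat) := WfrData {
  delta : R;
  len : R;                            (* the length L of the space interval *)
  rho_init : 'rV[R]_N1;
  rho_final : 'rV[R]_N1;
  Hrho : 'I_d -> 'M[R]_(N0, N1);
  Homega : 'I_d -> 'M[R]_(N0, N1);
  Hzeta : 'I_d -> 'M[R]_(N0, N1);
  box_lower : 'I_d -> 'I_N0 -> \bar R;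
  box_upper : 'I_d -> 'I_N0 -> \bar R
}.

Definition h0 (R : realType) (N0 N1 d : nat) (D : wfr_data R N0 N1 d) : R :=
  1 / N0%:R.
Definition h1 (R : realType) (N0 N1 d : nat) (D : wfr_data R N0 N1 d) : R :=
  len D / N1%:R.

(* Positions j and j + 1, for a cell index j < n, on the staggered grid
   0, ..., n. *)
Definition sleft (n : nat) (j : 'I_n) : 'I_n.+1 := widen_ord (leqnSn n) j.
Definition sright (n : nat) (j : 'I_n) : 'I_n.+1 := lift ord0 j.

(* In every array the row index is the time j0, the column index the space j1. *)
Definition Es (R : realType) (N0 N1 : nat) : Type :=
  ('M[R]_(N0.+1, N1) * 'M[R]_(N0, N1.+1) * 'M[R]_(N0, N1))%type.
Definition Ec (R : realType) (N0 N1 : nat) : Type :=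
  ('M[R]_(N0, N1) * 'M[R]_(N0, N1) * 'M[R]_(N0, N1))%type.

Definition rhobar (R : realType) (N0 N1 : nat) (U : Es R N0 N1) := U.1.1.
Definition omegabar (R : realType) (N0 N1 : nat) (U : Es R N0 N1) := U.1.2.
Definition zetabar (R : realType) (N0 N1 : nat) (U : Es R N0 N1) := U.2.
Definition rho (R : realType) (N0 N1 : nat) (V : Ec R N0 N1) := V.1.1.
Definition omega (R : realType) (N0 N1 : nat) (V : Ec R N0 N1) := V.1.2.
Definition zeta (R : realType) (N0 N1 : nat) (V : Ec R N0 N1) := V.2.

Definition interp (R : realType) (N0 N1 : nat) (U : Es R N0 N1) : Ec R N0 N1 :=
  (\matrix_(j0, j1) (2^-1 * (rhobar U (sleft j0) j1 + rhobar U (sright j0) j1)),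
   \matrix_(j0, j1)
     (2^-1 * (omegabar U j0 (sleft j1) + omegabar U j0 (sright j1))),
   zetabar U).

Definition CE (R : realType) (N0 N1 d : nat) (D : wfr_data R N0 N1 d) :
    set (Es R N0 N1) :=
  [set U |
    [/\ forall (j0 : 'I_N0) (j1 : 'I_N1),
          (rhobar U (sright j0) j1 - rhobar U (sleft j0) j1) / h0 D
          + (omegabar U j0 (sright j1) - omegabar U j0 (sleft j1)) / h1 D
          = zetabar U j0 j1,
        forall j1 : 'I_N1, rhobar U ord0 j1 = rho_init D 0 j1,
        forall j1 : 'I_N1, rhobar U ord_max j1 = rho_final D 0 j1,
        forall j0 : 'I_N0, omegabar U j0 ord0 = 0 &
        forall j0 : 'I_N0, omegabar U j0 ord_max = 0]].

Definition fdelta (R : realType) (delta r w z : R) : \bar R :=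
  if 0 < r then ((w ^+ 2 + delta ^+ 2 * z ^+ 2) / (2 * r))%:E
  else if [&& r == 0, w == 0 & z == 0] then 0%E else +oo%E.

Definition J (R : realType) (N0 N1 d : nat) (D : wfr_data R N0 N1 d)
    (V : Ec R N0 N1) : \bar R :=
  (\sum_(j0 < N0) \sum_(j1 < N1)
    fdelta (delta D) (rho V j0 j1) (omega V j0 j1) (zeta V j0 j1)
    * (h0 D * h1 D)%:E)%E.

Definition box (R : realType) (N0 N1 d : nat) (D : wfr_data R N0 N1 d)
    (i : 'I_d) : set (Ec R N0 N1) :=
  [set V | forall j0 : 'I_N0,
    let s := \sum_(j1 < N1)
      (Hrho D i j0 j1 * rho V j0 j1 + Homega D i j0 j1 * omega V j0 j1
       + Hzeta D i j0 j1 * zeta V j0 j1) * h1 D in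
    (box_lower D i j0 <= s%:E)%E /\ (s%:E <= box_upper D i j0)%E].

Definition cvx_indic (R : realType) (T : Type) (S : set T) (x : T) : \bar R :=
  if `[< S x >] then 0%E else +oo%E.

Definition objective (R : realType) (N0 N1 d : nat) (D : wfr_data R N0 N1 d)
    (UV : Es R N0 N1 * Ec R N0 N1) : \bar R :=
  (J D UV.2 + cvx_indic R (CE D) UV.1
   + cvx_indic R [set UV' : Es R N0 N1 * Ec R N0 N1 | UV'.2 = interp UV'.1] UV
   + \sum_(i < d) cvx_indic R (box D i) UV.2)%E.

Definition feasible_set (R : realType) (N0 N1 d : nat)
    (D : wfr_data R N0 N1 d) : set (Es R N0 N1 * Ec R N0 N1) :=
  [set UV | [/\ CE D UV.1, UV.2 = interp UV.1, forall i : 'I_d, box D i UV.2 &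
                (J D UV.2 < +oo)%E]].

Definition is_minimizer (R : realType) (T : Type) (f : T -> \bar R) (x : T) :
    Prop :=
  forall y : T, (f x <= f y)%E.

(* The library norm of a matrix is the sup norm, hence this definition. *)
Definition norm2 (R : realType) (k : nat) (x : 'cV[R]_k) : R :=
  Num.sqrt (\sum_(i < k) x i 0 ^+ 2).

Record soc_constraint (R : realType) (m : nat) := SocConstraint {
  soc_dim : nat;
  soc_A : 'M[R]_(soc_dim, m);
  soc_b : 'cV[R]_soc_dim;
  soc_c : 'rV[R]_m;
  soc_e : R
}.

Record socp (R : realType) (m : nat) := Socp {
  socp_eqs : seq ('rV[R]_m * R);
  socp_ineqs : seq ('rV[R]_m * R);
  socp_cones : seq (soc_constraint R m)
}.

Definition soc_holds (R : realType) (m : nat) (K : soc_constraint R m)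
    (x : 'cV[R]_m) : bool :=
  norm2 (soc_A K *m x + soc_b K) <= (soc_c K *m x) 0 0 + soc_e K.

Definition socp_solution (R : realType) (m : nat) (P : socp R m)
    (x : 'cV[R]_m) : bool :=
  [&& all (fun p : 'rV[R]_m * R => (p.1 *m x) 0 0 == p.2) (socp_eqs P),
      all (fun p : 'rV[R]_m * R => (p.1 *m x) 0 0 <= p.2) (socp_ineqs P) &
      all (fun K => soc_holds K x) (socp_cones P)].

Definition socp_solvable (R : realType) (m : nat) (P : socp R m) : Prop :=
  exists x : 'cV[R]_m, socp_solution P x.

(* Names of the scalar variables: the entries of U, the entries of V, and one
   auxiliary variable t per centered cell. *)
Definition staggered_var (N0 N1 : nat) : finType :=
  ('I_N0.+1 * 'I_N1 + 'I_N0 * 'I_N1.+1 + 'I_N0 * 'I_N1)%type.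
Definition centered_var (N0 N1 : nat) : finType :=
  ('I_N0 * 'I_N1 + 'I_N0 * 'I_N1 + 'I_N0 * 'I_N1)%type.
Definition wfr_var (N0 N1 : nat) : finType :=
  (staggered_var N0 N1 + centered_var N0 N1 + 'I_N0 * 'I_N1)%type.

(* The linear form on R^m, m = #|wfr_var N0 N1|, that reads one variable. *)
Definition read (R : realType) (N0 N1 : nat) (v : wfr_var N0 N1) :
    'rV[R]_#|wfr_var N0 N1| :=
  delta_mx 0 (enum_rank v).

Definition x_rhobar (R : realType) (N0 N1 : nat) (j0 : 'I_N0.+1) (j1 : 'I_N1) :=
  @read R N0 N1 (inl (inl (inl (inl (j0, j1))))).
Definition x_omegabar (R : realType) (N0 N1 : nat)
    (j0 : 'I_N0) (j1 : 'I_N1.+1) :=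
  @read R N0 N1 (inl (inl (inl (inr (j0, j1))))).
Definition x_zetabar (R : realType) (N0 N1 : nat) (j0 : 'I_N0) (j1 : 'I_N1) :=
  @read R N0 N1 (inl (inl (inr (j0, j1)))).
Definition x_rho (R : realType) (N0 N1 : nat) (j0 : 'I_N0) (j1 : 'I_N1) :=
  @read R N0 N1 (inl (inr (inl (inl (j0, j1))))).
Definition x_omega (R : realType) (N0 N1 : nat) (j0 : 'I_N0) (j1 : 'I_N1) :=
  @read R N0 N1 (inl (inr (inl (inr (j0, j1))))).
Definition x_zeta (R : realType) (N0 N1 : nat) (j0 : 'I_N0) (j1 : 'I_N1) :=
  @read R N0 N1 (inl (inr (inr (j0, j1)))).
Definition x_t (R : realType) (N0 N1 : nat) (j0 : 'I_N0) (j1 : 'I_N1) :=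
  @read R N0 N1 (inr (j0, j1)).

Definition CE_eqs (R : realType) (N0 N1 d : nat) (D : wfr_data R N0 N1 d) :
    seq ('rV[R]_#|wfr_var N0 N1| * R) :=
  [seq ((h0 D)^-1 *: (x_rhobar R (sright j0) j1 - x_rhobar R (sleft j0) j1)
        + (h1 D)^-1 *: (x_omegabar R j0 (sright j1) - x_omegabar R j0 (sleft j1))
        - x_zetabar R j0 j1, 0) | j0 <- enum 'I_N0, j1 <- enum 'I_N1]
  ++ [seq (x_rhobar R (ord0 : 'I_N0.+1) j1, rho_init D 0 j1)
        | j1 <- enum 'I_N1]
  ++ [seq (x_rhobar R (ord_max : 'I_N0.+1) j1, rho_final D 0 j1)
        | j1 <- enum 'I_N1]
  ++ [seq (x_omegabar R j0 (ord0 : 'I_N1.+1), 0) | j0 <- enum 'I_N0]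
  ++ [seq (x_omegabar R j0 (ord_max : 'I_N1.+1), 0) | j0 <- enum 'I_N0].

Definition interp_eqs (R : realType) (N0 N1 : nat) :
    seq ('rV[R]_#|wfr_var N0 N1| * R) :=
  [seq (x_rho R j0 j1
        - 2^-1 *: (x_rhobar R (sleft j0) j1 + x_rhobar R (sright j0) j1), 0)
     | j0 <- enum 'I_N0, j1 <- enum 'I_N1]
  ++ [seq (x_omega R j0 j1
           - 2^-1 *: (x_omegabar R j0 (sleft j1) + x_omegabar R j0 (sright j1)),
           0) | j0 <- enum 'I_N0, j1 <- enum 'I_N1]
  ++ [seq (x_zeta R j0 j1 - x_zetabar R j0 j1, 0)
        | j0 <- enum 'I_N0, j1 <- enum 'I_N1].

Definition box_form (R : realType) (N0 N1 d : nat) (D : wfr_data R N0 N1 d)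
    (i : 'I_d) (j0 : 'I_N0) : 'rV[R]_#|wfr_var N0 N1| :=
  \sum_(j1 < N1) h1 D *: (Hrho D i j0 j1 *: x_rho R j0 j1
    + Homega D i j0 j1 *: x_omega R j0 j1 + Hzeta D i j0 j1 *: x_zeta R j0 j1).

(* A vacuous bound gives no inequality; an unsatisfiable one (lower bound +oo
   or upper bound -oo) gives 0 <= -1. *)
Definition lower_ineq (R : realType) (m : nat) (a : 'rV[R]_m) (l : \bar R) :
    seq ('rV[R]_m * R) :=
  match l with
  | EFin l' => [:: (- a, - l')]
  | -oo%E => [::]
  | +oo%E => [:: (0, -1)]
  end.

Definition upper_ineq (R : realType) (m : nat) (a : 'rV[R]_m) (u : \bar R) :
    seq ('rV[R]_m * R) :=
  match u with
  | EFin u' => [:: (a, u')]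
  | +oo%E => [::]
  | -oo%E => [:: (0, -1)]
  end.

Definition box_ineqs (R : realType) (N0 N1 d : nat) (D : wfr_data R N0 N1 d) :
    seq ('rV[R]_#|wfr_var N0 N1| * R) :=
  flatten [seq lower_ineq (box_form D i j0) (box_lower D i j0)
               ++ upper_ineq (box_form D i j0) (box_upper D i j0)
             | i <- enum 'I_d, j0 <- enum 'I_N0].

(* The epigraph constraint fdelta rho omega zeta <= t, that is rho, t >= 0 and
   omega ^ 2 + delta ^ 2 zeta ^ 2 <= 2 rho t, written as
   |(2 omega, 2 delta zeta, rho - 2 t)| <= rho + 2 t. *)
Definition cost_cone (R : realType) (N0 N1 d : nat) (D : wfr_data R N0 N1 d)
    (j0 : 'I_N0) (j1 : 'I_N1) : soc_constraint R #|wfr_var N0 N1| :=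
  @SocConstraint R #|wfr_var N0 N1| 3
    (\matrix_(k < 3) [:: 2 *: x_omega R j0 j1;
                         (2 * delta D) *: x_zeta R j0 j1;
                         x_rho R j0 j1 - 2 *: x_t R j0 j1]`_k)
    0
    (x_rho R j0 j1 + 2 *: x_t R j0 j1)
    0.

Definition wfr_socp (R : realType) (N0 N1 d : nat) (D : wfr_data R N0 N1 d) :
    socp R #|wfr_var N0 N1| :=
  Socp (CE_eqs D ++ interp_eqs R N0 N1)
       (box_ineqs D)
       [seq cost_cone D j0 j1 | j0 <- enum 'I_N0, j1 <- enum 'I_N1].

(* Main.v *)
Require Import Defs.
From mathcomp Require Import all_boot all_order all_algebra.
From mathcomp Require Import all_classical all_reals all_analysis.
From mathcomp Require Import ring lra.

(* Both claims come from the linear epigraph form of the problem: minimize the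
   sum of h0 h1 t over the solution set of the second-order cone program, whose
   cones say exactly fdelta <= t.  This set is closed, so it is enough to bound
   its sublevel sets.  There t <= T, hence zeta ^ 2 and omega ^ 2 are at most a
   constant times rho >= 0.  Summing the continuity equation over space kills the
   fluxes, so the total mass M_k at time k grows only through zeta, and AM-GM
   gives M_{k+1} <= 3 |M_k| + const, while rho >= 0 gives M_{k+1} >= - M_k.  So
   all masses are bounded, then rho, zeta and omega; finally rhobar and omegabar
   are recovered from their midpoint averages and their boundary values. *)

Set Implicit Arguments.
Unset Strict Implicit.
Unset Printing Implicit Defensive.

Import Order.TTheory GRing.Theory Num.Theory.
Import numFieldNormedType.Exports.

Local Open Scope classical_set_scope.
Local Open Scope ring_scope.

(** * Attainment in second-order cone programs *)

Lemma mulmx_trmx_continuous (R : realType) (k m : nat) (A : 'M[R]_(k, m)) i :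
  continuous (fun y : 'rV[R]_m => (A *m y^T) i 0).
Proof.
have -> : (fun y : 'rV[R]_m => (A *m y^T) i 0)
        = (fun y : 'rV[R]_m => \sum_(j < m) A i j * y 0 j).
  by apply/funext => y; rewrite mxE; apply: eq_bigr => j _; rewrite mxE.
apply: continuous_big => [|j _ y]; first exact: add_continuous.
by apply: continuousM; [exact: cst_continuous | exact: coord_continuous].
Qed.

Lemma closed_le_fun (R : realType) (T : topologicalType) (f g : T -> R) :
  continuous f -> continuous g -> closed [set x | f x <= g x].
Proof.
move=> cf cg.
have -> : [set x | f x <= g x] = (fun x => g x - f x) @^-1` [set z | 0 <= z].
  by apply/seteqP; split=> x /=; rewrite subr_ge0.
apply: preimage_closed; last exact: closed_ge.
by move=> x _; apply: continuousB; [exact: cg | exact: cf].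
Qed.

Lemma closed_all (T : topologicalType) (I : Type) (s : seq I)
    (p : I -> T -> bool) :
  (forall i, closed [set x | p i x]) -> closed [set x | all (p^~ x) s].
Proof.
move=> cp; elim: s => [|i s IHs].
  rewrite [X in closed X](_ : _ = setT); first exact: closedT.
  by apply/seteqP; split.
rewrite [X in closed X](_ : _ = [set x | p i x] `&` [set x | all (p^~ x) s]).
  exact: closedI.
by apply/seteqP; split=> x /= => [/andP[]|[-> ->]].
Qed.

(** Each constraint is an equality or a non-strict inequality between continuous functions of the
    unknown, and there are finitely many. The unknown is a transposed row so that compactness of
    boxes of row vectors applies later. *)
Lemma socp_solution_closed (R : realType) (m : nat) (P : socp R m) :
  closed [set y : 'rV[R]_m | socp_solution P y^T].
Proof.
have cform (a : 'rV[R]_m) : continuous (fun y : 'rV[R]_m => (a *m y^T) 0 0).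
  exact: mulmx_trmx_continuous.
rewrite [X in closed X](_ : _ =
  [set y : 'rV[R]_m | all (fun p : 'rV_m * R => (p.1 *m y^T) 0 0 == p.2)
                          (socp_eqs P)]
  `&` [set y : 'rV[R]_m | all (fun p : 'rV_m * R => (p.1 *m y^T) 0 0 <= p.2)
                              (socp_ineqs P)]
  `&` [set y : 'rV[R]_m | all (fun K => soc_holds K y^T) (socp_cones P)]);
  last first.
  by apply/seteqP; split=> y /= => [/and3P[]|[[? ?] ?]]; last exact/and3P.
apply: closedI; first apply: closedI.
- apply: (@closed_all _ _ _ (fun p : 'rV_m * R =>
    fun y : 'rV[R]_m => (p.1 *m y^T) 0 0 == p.2)) => p.
  rewrite [X in closed X](_ : _ =
    (fun y : 'rV[R]_m => (p.1 *m y^T) 0 0) @^-1` [set z | z = p.2]).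
    by apply: preimage_closed (@closed_eq _ _) => y _; exact: cform.
  by apply/seteqP; split=> y /= /eqP.
- apply: (@closed_all _ _ _ (fun p : 'rV_m * R =>
    fun y : 'rV[R]_m => (p.1 *m y^T) 0 0 <= p.2)) => p.
  by apply: closed_le_fun => // y; exact: cst_continuous.
apply: (@closed_all _ _ _ (fun K => fun y : 'rV[R]_m => soc_holds K y^T)) => K.
apply: closed_le_fun; last first.
  by move=> y; apply: continuousD; [exact: cform | exact: cst_continuous].
have csum : continuous (fun y : 'rV[R]_m =>
    \sum_(i < soc_dim K) (soc_A K *m y^T + soc_b K) i 0 ^+ 2).
  apply: continuous_big => [|i _ y]; first exact: add_continuous.
  have ccoord : continuous (fun z : 'rV[R]_m => (soc_A K *m z^T + soc_b K) i 0).
    rewrite [X in continuous X](_ : _ =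
      fun z : 'rV[R]_m => (soc_A K *m z^T) i 0 + soc_b K i 0); last first.
      by apply/funext => z; rewrite mxE.
    move=> z; apply: continuousD; last exact: cst_continuous.
    exact: mulmx_trmx_continuous.
  exact: (continuousM (ccoord y) (ccoord y)).
move=> y; apply: (@cvg_comp _ _ _ _ Num.sqrt); first exact: csum.
exact: sqrt_continuous.
Qed.

(** Extreme value theorem on the solutions costing at most as much as [x0]: a closed subset of the
    cube of half-width [K], hence compact. *)
Lemma socp_min (R : realType) (m : nat) (P : socp R m) (c : 'rV[R]_m)
    (x0 : 'cV[R]_m) (K : R) :
  socp_solution P x0 ->
  (forall x, socp_solution P x -> (c *m x) 0 0 <= (c *m x0) 0 0 ->
     forall i, `|x i 0| <= K) ->
  exists2 x, socp_solution P x &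
    forall y, socp_solution P y -> (c *m x) 0 0 <= (c *m y) 0 0.
Proof.
move=> Px0 Kbound.
pose f (y : 'rV[R]_m) := (c *m y^T) 0 0.
have cf : continuous f by exact: mulmx_trmx_continuous.
pose A := [set y : 'rV[R]_m | socp_solution P y^T]
          `&` [set y | f y <= (c *m x0) 0 0].
have A0 : A !=set0 by exists x0^T; split; rewrite /= /f trmxK.
have cA : compact A.
  have cube : compact [set v : 'rV[R]_m | forall i, v ord0 i \in `[- K, K]].
    apply: (@rV_compact _ _ (fun=> `[- K, K]%classic)) => _.
    exact: segment_compact.
  apply: subclosed_compact cube _.
    apply: closedI; first exact: socp_solution_closed.
    by apply: closed_le_fun => // y; exact: cst_continuous.
  move=> y [Py fy] i /=; rewrite in_itv /= -ler_norml.
  by have := Kbound _ Py fy i; rewrite mxE.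
have [y /set_mem[Py fy] ymin] := compact_EVT_min A0 cA (continuous_subspaceT cf).
(* A solution [z] outside [A] costs more than [x0], and [y] costs at most as much as [x0]. *)
exists y^T => // z Pz; have [fz|/ltW fz] := leP ((c *m z) 0 0) ((c *m x0) 0 0).
  have /ymin : z^T \in A by rewrite inE; split; rewrite /= /f trmxK.
  by rewrite /f trmxK.
exact: le_trans fz.
Qed.

(** * Feasibility as a second-order cone problem *)

Section LinearForm.
Variables (R : realType) (m : nat) (x : 'cV[R]_m).
Implicit Types a b : 'rV[R]_m.

Lemma formD a b : ((a + b) *m x) 0 0 = (a *m x) 0 0 + (b *m x) 0 0.
Proof. by rewrite mulmxDl mxE. Qed.

Lemma formN a : ((- a) *m x) 0 0 = - (a *m x) 0 0.
Proof. by rewrite mulNmx mxE. Qed.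

Lemma formZ k a : ((k *: a) *m x) 0 0 = k * (a *m x) 0 0.
Proof. by rewrite -scalemxAl mxE. Qed.

Lemma form_sum n (a : 'I_n -> 'rV[R]_m) :
  ((\sum_(i < n) a i) *m x) 0 0 = \sum_(i < n) (a i *m x) 0 0.
Proof. by rewrite mulmx_suml summxE. Qed.

Definition formE := (formD, formN, formZ, form_sum).

End LinearForm.

Lemma sqrtr_leE (R : realType) (s e : R) : 0 <= s ->
  (Num.sqrt s <= e) = (0 <= e) && (s <= e ^+ 2).
Proof.
move=> s0; have [e0|e0] /= := leP 0 e; last first.
  by apply/negbTE; rewrite -ltNge; exact: lt_le_trans (sqrtr_ge0 s).
by rewrite -[RHS]ler_psqrt ?nnegrE ?sqr_ge0// sqrtr_sqr ger0_norm.
Qed.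

(** Rotated cone: the quadratic inequality is [w ^ 2 + dlt ^ 2 * z ^ 2 <= 2 * r * t]. If [0 < r], it
    forces [0 <= t], hence the sign condition. If [r < 0], the sign condition forces [0 < t], so the
    right side is negative. If [r = 0], it forces [w = z = 0]. *)
Lemma fdelta_le (R : realType) (dlt r w z t : R) : 0 < dlt ->
  (fdelta dlt r w z <= t%:E)%E =
  (0 <= r + 2 * t) &&
  ((2 * w) ^+ 2 + (2 * dlt * z) ^+ 2 + (r - 2 * t) ^+ 2 <= (r + 2 * t) ^+ 2).
Proof.
move=> dlt0; rewrite /fdelta.
(* The identity [(r + 2t)^2 - (r - 2t)^2 = 8rt], divided by 4. *)
have -> : ((2 * w) ^+ 2 + (2 * dlt * z) ^+ 2 + (r - 2 * t) ^+ 2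
    <= (r + 2 * t) ^+ 2) = (w ^+ 2 + dlt ^+ 2 * z ^+ 2 <= t * (2 * r)).
  by apply/idP/idP => h; lra.
have w2 := sqr_ge0 w; have z2 := sqr_ge0 z.
have d2 : 0 < dlt ^+ 2 by rewrite exprn_gt0.
have dz2 : 0 <= dlt ^+ 2 * z ^+ 2 by rewrite mulr_ge0// ltW.
have [r0|r0] := ltP 0 r.
  rewrite lee_fin ler_pdivrMr ?mulr_gt0//.
  case: leP => h; rewrite ?andbF// andbT; apply/esym.
  have t0 : 0 <= t * (2 * r) by apply: le_trans h; exact: addr_ge0.
  rewrite pmulr_lge0 ?mulr_gt0// in t0.
  by rewrite addr_ge0// ?mulr_ge0// ltW.
have [->|rN0] := eqVneq r 0; last first.
  have {}r0 : r < 0 by rewrite lt_neqAle rN0.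
  rewrite /= leye_eq; apply/esym/negP => /andP[t0 h].
  have tr : t * (2 * r) < 0 by rewrite pmulr_rlt0; lra.
  lra.
rewrite add0r !mulr0; case: ifPn => /= [/andP[/eqP -> /eqP ->]|wz].
  by rewrite lee_fin !expr0n /= mulr0 addr0 lexx andbT pmulr_rge0.
rewrite leye_eq; apply/esym/negP => /andP[t0 h]; move/negP: wz; apply.
have w0 : w ^+ 2 = 0 by lra.
have : dlt ^+ 2 * z ^+ 2 = 0 by lra.
move/eqP; rewrite mulf_eq0 (gt_eqF d2) /= => z0.
by rewrite sqrf_eq0 in z0; rewrite z0 andbT -sqrf_eq0 w0.
Qed.

(** * Dictionary between points of the program and triples [(U, V, t)] *)

Section Decode.
Variables (R : realType) (N0 N1 d : nat) (D : wfr_data R N0 N1 d).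
Local Notation m := #|wfr_var N0 N1|.
Implicit Type x : 'cV[R]_m.

Definition staggered_of x : Es R N0 N1 :=
  (\matrix_(j0, j1) (x_rhobar R j0 j1 *m x) 0 0,
   \matrix_(j0, j1) (x_omegabar R j0 j1 *m x) 0 0,
   \matrix_(j0, j1) (x_zetabar R j0 j1 *m x) 0 0).

Definition centered_of x : Ec R N0 N1 :=
  (\matrix_(j0, j1) (x_rho R j0 j1 *m x) 0 0,
   \matrix_(j0, j1) (x_omega R j0 j1 *m x) 0 0,
   \matrix_(j0, j1) (x_zeta R j0 j1 *m x) 0 0).

Definition epi_of x : 'M[R]_(N0, N1) :=
  \matrix_(j0, j1) (x_t R j0 j1 *m x) 0 0.

(** A common section of the three decoders above; it turns a feasible pair into a point of the
    program. *)
Definition encode (U : Es R N0 N1) (V : Ec R N0 N1) (t : 'M[R]_(N0, N1)) :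
    'cV[R]_m :=
  \col_k match enum_val k with
         | inl (inl (inl (inl j))) => rhobar U j.1 j.2
         | inl (inl (inl (inr j))) => omegabar U j.1 j.2
         | inl (inl (inr j)) => zetabar U j.1 j.2
         | inl (inr (inl (inl j))) => rho V j.1 j.2
         | inl (inr (inl (inr j))) => omega V j.1 j.2
         | inl (inr (inr j)) => zeta V j.1 j.2
         | inr j => t j.1 j.2
         end.

Lemma read_mul (v : wfr_var N0 N1) x : (read R v *m x) 0 0 = x (enum_rank v) 0.
Proof.
rewrite mxE (bigD1 (enum_rank v)) //= big1 => [|k kv].
  by rewrite mxE !eqxx mul1r addr0.
by rewrite mxE (negbTE kv) andbF mul0r.
Qed.

Lemma rhobarE x j0 j1 :
  rhobar (staggered_of x) j0 j1 = (x_rhobar R j0 j1 *m x) 0 0.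
Proof. by rewrite [LHS]mxE. Qed.

Lemma omegabarE x j0 j1 :
  omegabar (staggered_of x) j0 j1 = (x_omegabar R j0 j1 *m x) 0 0.
Proof. by rewrite [LHS]mxE. Qed.

Lemma zetabarE x j0 j1 :
  zetabar (staggered_of x) j0 j1 = (x_zetabar R j0 j1 *m x) 0 0.
Proof. by rewrite [LHS]mxE. Qed.

Lemma rhoE x j0 j1 : rho (centered_of x) j0 j1 = (x_rho R j0 j1 *m x) 0 0.
Proof. by rewrite [LHS]mxE. Qed.

Lemma omegaE x j0 j1 : omega (centered_of x) j0 j1 = (x_omega R j0 j1 *m x) 0 0.
Proof. by rewrite [LHS]mxE. Qed.

Lemma zetaE x j0 j1 : zeta (centered_of x) j0 j1 = (x_zeta R j0 j1 *m x) 0 0.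
Proof. by rewrite [LHS]mxE. Qed.

Lemma epiE x j0 j1 : epi_of x j0 j1 = (x_t R j0 j1 *m x) 0 0.
Proof. by rewrite [LHS]mxE. Qed.

Definition decodeE :=
  (rhobarE, omegabarE, zetabarE, rhoE, omegaE, zetaE, epiE).

Lemma rho_interp (U : Es R N0 N1) j0 j1 : rho (interp U) j0 j1 =
  2^-1 * (rhobar U (sleft j0) j1 + rhobar U (sright j0) j1).
Proof. by rewrite [LHS]mxE. Qed.

Lemma omega_interp (U : Es R N0 N1) j0 j1 : omega (interp U) j0 j1 =
  2^-1 * (omegabar U j0 (sleft j1) + omegabar U j0 (sright j1)).
Proof. by rewrite [LHS]mxE. Qed.

Lemma staggered_of_encode U V t : staggered_of (encode U V t) = U.
Proof.
case: U => [[r w] z]; congr (_, _, _); apply/matrixP => j0 j1;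
by rewrite mxE read_mul mxE enum_rankK.
Qed.

Lemma centered_of_encode U V t : centered_of (encode U V t) = V.
Proof.
case: V => [[r w] z]; congr (_, _, _); apply/matrixP => j0 j1;
by rewrite mxE read_mul mxE enum_rankK.
Qed.

Lemma epi_of_encode U V t : epi_of (encode U V t) = t.
Proof. by apply/matrixP => j0 j1; rewrite mxE read_mul mxE enum_rankK. Qed.

Lemma cost_coneE x j0 j1 : 0 < delta D ->
  soc_holds (cost_cone D j0 j1) x =
  (fdelta (delta D) (rho (centered_of x) j0 j1) (omega (centered_of x) j0 j1)
     (zeta (centered_of x) j0 j1) <= (epi_of x j0 j1)%:E)%E.
Proof.
move=> dlt0; rewrite fdelta_le // /soc_holds.
have rowE (k : 'I_3) :
  (soc_A (cost_cone D j0 j1) *m x + soc_b (cost_cone D j0 j1)) k 0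
    = ([:: 2 *: x_omega R j0 j1; (2 * delta D) *: x_zeta R j0 j1;
         x_rho R j0 j1 - 2 *: x_t R j0 j1]`_k *m x) 0 0.
  by rewrite /= addr0 !mxE; apply: eq_bigr => i _; rewrite mxE.
have -> : norm2 (soc_A (cost_cone D j0 j1) *m x + soc_b (cost_cone D j0 j1))
  = Num.sqrt (\sum_(k < 3) ([:: 2 *: x_omega R j0 j1;
      (2 * delta D) *: x_zeta R j0 j1;
      x_rho R j0 j1 - 2 *: x_t R j0 j1]`_k *m x) 0 0 ^+ 2).
  by congr Num.sqrt; apply: eq_bigr => k _; rewrite rowE.
rewrite !big_ord_recl big_ord0 addr0 /= !formE addr0.
rewrite sqrtr_leE; last by rewrite !addr_ge0 ?sqr_ge0.
by rewrite !decodeE addrA.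
Qed.

(** * The constraint lists read as conditions on the decoded arrays *)

Lemma all_flatten_seq (T : Type) (p : pred T) (ss : seq (seq T)) :
  all p (flatten ss) = all (all p) ss.
Proof. by elim: ss => //= s ss IHss; rewrite all_cat IHss. Qed.

Lemma all_enum2P (I J : finType) (T : Type) (p : pred T) (f : I -> J -> T) :
  reflect (forall i j, p (f i j)) (all p [seq f i j | i <- enum I, j <- enum J]).
Proof.
apply: (iffP all_allpairsP) => h i j; last by move=> _ _; exact: h.
by apply: h; rewrite mem_enum.
Qed.

Lemma all_enumP (I : finType) (T : Type) (p : pred T) (f : I -> T) :
  reflect (forall i, p (f i)) (all p [seq f i | i <- enum I]).
Proof.
rewrite all_map; apply: (iffP allP) => h i; last by move=> _; exact: h.
by apply: h; rewrite mem_enum.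
Qed.

Lemma CE_eqsP x :
  all (fun p : 'rV[R]_m * R => (p.1 *m x) 0 0 == p.2) (CE_eqs D)
  <-> CE D (staggered_of x).
Proof.
rewrite !all_cat; split.
  move=> /and5P[/all_enum2P h1 /all_enumP h2 /all_enumP h3 /all_enumP h4
    /all_enumP h5].
  split=> [j0 j1|j1|j1|j0|j0]; rewrite ?decodeE.
  - apply/eqP; have := h1 j0 j1; rewrite /= !formE subr_eq0.
    (* The forms have the inverse steps as left factors, whereas [CE] divides on the right. *)
    by rewrite mulrC [X in _ + X == _]mulrC.
  - exact/eqP/h2.
  - exact/eqP/h3.
  - exact/eqP/h4.
  - exact/eqP/h5.
case=> h1 h2 h3 h4 h5; apply/and5P; split.
- apply/all_enum2P => j0 j1 /=; have /eqP := h1 j0 j1.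
  rewrite !decodeE !formE subr_eq0.
  by rewrite mulrC [X in _ + X == _]mulrC.
- by apply/all_enumP => j /=; rewrite -h2 decodeE.
- by apply/all_enumP => j /=; rewrite -h3 decodeE.
- by apply/all_enumP => j /=; rewrite -(h4 j) decodeE.
- by apply/all_enumP => j /=; rewrite -(h5 j) decodeE.
Qed.

Lemma interp_eqsP x :
  all (fun p : 'rV[R]_m * R => (p.1 *m x) 0 0 == p.2) (interp_eqs R N0 N1)
  <-> centered_of x = interp (staggered_of x).
Proof.
rewrite !all_cat; split.
  move=> /and3P[/all_enum2P h1 /all_enum2P h2 /all_enum2P h3].
  have eqV (V W : Ec R N0 N1) :
      (forall j0 j1, rho V j0 j1 = rho W j0 j1) ->
      (forall j0 j1, omega V j0 j1 = omega W j0 j1) ->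
      (forall j0 j1, zeta V j0 j1 = zeta W j0 j1) -> V = W.
    case: V W => [[r w] z] [[r' w'] z'] /= er ew ez.
    by congr (_, _, _); apply/matrixP => j0 j1; [exact: er|exact: ew|exact: ez].
  apply: eqV => j0 j1.
  - by have := h1 j0 j1; rewrite rho_interp !decodeE /= !formE subr_eq0 => /eqP.
  - by have := h2 j0 j1; rewrite omega_interp !decodeE /= !formE subr_eq0 => /eqP.
  - have := h3 j0 j1; rewrite decodeE /= !formE subr_eq0 => /eqP ->.
    by rewrite -zetabarE.
move=> xE; apply/and3P; split;
  apply/all_enum2P => j0 j1; rewrite /= !formE subr_eq0; apply/eqP.
- by rewrite -rhoE xE rho_interp !decodeE.
- by rewrite -omegaE xE omega_interp !decodeE.
- by rewrite -zetaE xE -zetabarE.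
Qed.

Lemma lower_ineqE (n : nat) (y : 'cV[R]_n) (a : 'rV[R]_n) (l : \bar R) :
  all (fun p : 'rV[R]_n * R => (p.1 *m y) 0 0 <= p.2) (lower_ineq a l)
  = (l <= ((a *m y) 0 0)%:E)%E.
Proof.
case: l => [l||] /=; rewrite ?andbT.
- by rewrite formN lerN2 lee_fin.
- by rewrite mul0mx mxE leNgt ltrN10 leye_eq.
- by rewrite leNye.
Qed.

Lemma upper_ineqE (n : nat) (y : 'cV[R]_n) (a : 'rV[R]_n) (u : \bar R) :
  all (fun p : 'rV[R]_n * R => (p.1 *m y) 0 0 <= p.2) (upper_ineq a u)
  = (((a *m y) 0 0)%:E <= u)%E.
Proof.
case: u => [u||] /=; rewrite ?andbT.
- by rewrite lee_fin.
- by rewrite leey.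
- by rewrite mul0mx mxE leNgt ltrN10 leeNy_eq.
Qed.

Lemma box_ineqsP x :
  all (fun p : 'rV[R]_m * R => (p.1 *m x) 0 0 <= p.2) (box_ineqs D)
  <-> forall i : 'I_d, box D i (centered_of x).
Proof.
have formBox i j0 : (box_form D i j0 *m x) 0 0 = \sum_(j1 < N1)
      (Hrho D i j0 j1 * rho (centered_of x) j0 j1
       + Homega D i j0 j1 * omega (centered_of x) j0 j1
       + Hzeta D i j0 j1 * zeta (centered_of x) j0 j1) * h1 D.
  rewrite formE; apply: eq_bigr => j1 _.
  by rewrite !formE !decodeE mulrC.
rewrite /box_ineqs all_flatten_seq; split.
  move=> /all_enum2P h i j0; have := h i j0.
  by rewrite all_cat lower_ineqE upper_ineqE formBox => /andP[].
move=> h; apply/all_enum2P => i j0.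
rewrite all_cat lower_ineqE upper_ineqE formBox; apply/andP; exact: h.
Qed.

(** The auxiliary [t] is an arbitrary real upper bound of the cost of each cell; its existence
    encodes finiteness of the cost. *)
Lemma wfr_socpP x : 0 < delta D ->
  socp_solution (wfr_socp D) x <->
  [/\ CE D (staggered_of x), centered_of x = interp (staggered_of x),
      forall i : 'I_d, box D i (centered_of x) &
      forall j0 j1,
        (fdelta (delta D) (rho (centered_of x) j0 j1)
           (omega (centered_of x) j0 j1) (zeta (centered_of x) j0 j1)
         <= (epi_of x j0 j1)%:E)%E].
Proof.
move=> dlt0; rewrite /socp_solution /= all_cat; split.
  move=> /and3P[/andP[/CE_eqsP ? /interp_eqsP ?] /box_ineqsP ? /all_enum2P h].
  by split=> // j0 j1; rewrite -cost_coneE.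
case=> /CE_eqsP -> /interp_eqsP -> /box_ineqsP -> h /=.
by apply/all_enum2P => j0 j1; rewrite cost_coneE.
Qed.

End Decode.

(** * Coercivity *)

(** Keeps the bound existential, so that bounds pass through linear relations without explicit
    constants. *)
Definition bounded_on (R : realType) (X : Type) (S : set X) (f : X -> R) :=
  exists K : R, forall x, S x -> `|f x| <= K.

Section BoundedOn.
Variables (R : realType) (X : Type) (S : set X).
Implicit Types f g : X -> R.

Lemma bounded_on_cst (c : R) : bounded_on S (fun=> c).
Proof. by exists `|c|. Qed.

Lemma bounded_on_le f g :
  (forall x, S x -> `|f x| <= g x) -> bounded_on S g -> bounded_on S f.
Proof.
by move=> fg [K gK]; exists K => x Sx;
  rewrite (le_trans (fg x Sx))// (le_trans (ler_norm _))// gK.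
Qed.

Lemma bounded_onD f g :
  bounded_on S f -> bounded_on S g -> bounded_on S (fun x => f x + g x).
Proof.
move=> [K fK] [L gL]; exists (K + L) => x Sx.
by rewrite (le_trans (ler_normD _ _))// lerD// (fK, gL).
Qed.

Lemma bounded_onZ (c : R) f : bounded_on S f -> bounded_on S (fun x => c * f x).
Proof.
by move=> [K fK]; exists (`|c| * K) => x Sx; rewrite normrM ler_wpM2l// fK.
Qed.

Lemma bounded_on_eq f g :
  (forall x, S x -> f x = g x) -> bounded_on S g -> bounded_on S f.
Proof. by move=> fg [K gK]; exists K => x Sx; rewrite fg// gK. Qed.

Lemma bounded_on_abs f : bounded_on S f -> bounded_on S (fun x => `|f x|).
Proof. by move=> [K fK]; exists K => x Sx; rewrite normr_id fK. Qed.

Lemma bounded_on_sum n (f : 'I_n -> X -> R) :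
  (forall i, bounded_on S (f i)) -> bounded_on S (fun x => \sum_(i < n) f i x).
Proof.
move=> /fin_all_exists[K fK]; exists (\sum_(i < n) K i) => x Sx.
by rewrite (le_trans (ler_norm_sum _ _ _))// ler_sum// => i _; exact: fK.
Qed.

End BoundedOn.

(** * Induction and summation on a staggered grid *)

Lemma staggered_ind (n : nat) (P : 'I_n.+1 -> Prop) :
  P ord0 -> (forall j : 'I_n, P (sleft j) -> P (sright j)) -> forall k, P k.
Proof.
move=> P0 PS [k kn]; elim: k kn => [|k IHk] kn.
  by rewrite (_ : Ordinal kn = ord0) //; exact: val_inj.
have kn' : (k < n)%N by [].
rewrite (_ : Ordinal kn = sright (Ordinal kn')); last exact: val_inj.
apply: PS; rewrite (_ : sleft _ = Ordinal (ltnW kn)); first exact: IHk.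
exact: val_inj.
Qed.

(** The sum of [f] over all grid points is split in two ways, taking off the first or the last
    point. *)
Lemma sum_staggered_diff (R : realType) (n : nat) (f : 'I_n.+1 -> R) :
  \sum_(j < n) (f (sright j) - f (sleft j)) = f ord_max - f ord0.
Proof.
have e : f ord0 + \sum_(j < n) f (sright j)
    = \sum_(j < n) f (sleft j) + f ord_max.
  by transitivity (\sum_j f j); [rewrite big_ord_recl | rewrite big_ord_recr].
by rewrite sumrB; lra.
Qed.

Lemma fdelta_ge0 (R : realType) (dlt r w z : R) : (0 <= fdelta dlt r w z)%E.
Proof.
rewrite /fdelta; case: ifPn => [r0|_]; last by case: ifP.
rewrite lee_fin divr_ge0 ?mulr_ge0 ?(ltW r0) // addr_ge0 ?sqr_ge0 //.
by rewrite mulr_ge0 ?sqr_ge0.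
Qed.

Lemma fdelta_leW (R : realType) (dlt r w z t : R) :
  (fdelta dlt r w z <= t%:E)%E ->
  0 <= r /\ w ^+ 2 + dlt ^+ 2 * z ^+ 2 <= 2 * t * r.
Proof.
rewrite /fdelta; have [r0|_] := ltP 0 r.
  by rewrite lee_fin ler_pdivrMr ?mulr_gt0// => h; split; lra.
case: ifPn => // /and3P[/eqP-> /eqP-> /eqP->] _.
by rewrite expr0n /= !mulr0 addr0.
Qed.

(* AM-GM. *)
Lemma norm_le_linear (R : realType) (z r c e : R) : 0 <= r -> 0 <= c -> 0 < e ->
  z ^+ 2 <= c * r -> `|z| <= e * r + c / (4 * e).
Proof.
move=> r0 c0 e0 zcr.
have y0 : 0 <= e * r + c / (4 * e).
  by rewrite addr_ge0// ?mulr_ge0 ?invr_ge0 ?mulr_ge0 // ltW.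
rewrite -[leRHS]ger0_norm // -ler_sqr ?nnegrE // !real_normK ?num_real //.
apply: le_trans zcr _; rewrite -subr_ge0.
(* The cross term of the square is [c * r / 2]; subtracting [c * r] only flips its sign. *)
have -> : (e * r + c / (4 * e)) ^+ 2 - c * r = (e * r - c / (4 * e)) ^+ 2.
  by field; rewrite gt_eqF.
exact: sqr_ge0.
Qed.

(** * A priori bounds under the continuity equation and a cellwise cost bound *)

Section Coercivity.
Variables (R : realType) (N0 N1 d : nat) (D : wfr_data R N0 N1 d).
Hypotheses (hN0 : (0 < N0)%N) (hN1 : (0 < N1)%N).
Hypotheses (hdelta : 0 < delta D) (hL : 0 < len D).

Lemma h0_gt0 : 0 < h0 D.
Proof. by rewrite divr_gt0 ?ltr0n. Qed.

Lemma h1_gt0 : 0 < h1 D.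
Proof. by rewrite divr_gt0 ?ltr0n. Qed.

Definition mass (U : Es R N0 N1) (k : 'I_N0.+1) : R :=
  \sum_(j1 < N1) rhobar U k j1.

Lemma mass_interp U j0 : \sum_(j1 < N1) rho (interp U) j0 j1
  = 2^-1 * (mass U (sleft j0) + mass U (sright j0)).
Proof.
by rewrite -big_split mulr_sumr; apply: eq_bigr => j1 _; rewrite rho_interp.
Qed.

(* The fluxes telescope in space, with zero boundary values. *)
Lemma mass_balance U j0 : CE D U ->
  mass U (sright j0) - mass U (sleft j0)
  = h0 D * \sum_(j1 < N1) zetabar U j0 j1.
Proof.
move=> [ce _ _ w0 w1].
under eq_bigr do rewrite -ce.
rewrite big_split /= -!mulr_suml sum_staggered_diff w0 w1 subrr mul0r addr0.
by rewrite -sumrB mulrCA divff ?mulr1// gt_eqF// h0_gt0.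
Qed.

Variable T : R.
Hypothesis T0 : 0 <= T.

(** Stated in [U] alone: [V] is eliminated as [interp U], whose third component is [zetabar U]. *)
Definition CE_sublevel : set (Es R N0 N1) :=
  [set U | CE D U /\ forall j0 j1,
    (fdelta (delta D) (rho (interp U) j0 j1) (omega (interp U) j0 j1)
       (zetabar U j0 j1) <= T%:E)%E].

(** The constant in [zeta ^ 2 <= c * rho], which the cost bound gives once [omega ^ 2] is
    dropped. *)
Let c : R := 2 * T / delta D ^+ 2.

Let c_ge0 : 0 <= c.
Proof. by apply: divr_ge0; [exact: mulr_ge0 | exact: sqr_ge0]. Qed.

Lemma sublevel_rho_ge0 U j0 j1 : CE_sublevel U -> 0 <= rho (interp U) j0 j1.
Proof. by move=> [_ /(_ j0 j1)/fdelta_leW[]]. Qed.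

(** The slope [(h0 D)^-1] cancels the factor [h0 D] of [mass_balance]. The new mass then enters its
    own bound with coefficient 1/2, whatever the time step, and can be absorbed. *)
Lemma sublevel_zeta_le U j0 j1 : CE_sublevel U ->
  `|zetabar U j0 j1| <= (h0 D)^-1 * rho (interp U) j0 j1
                        + c / (4 * (h0 D)^-1).
Proof.
move=> [_ /(_ j0 j1)/fdelta_leW[r0 h]].
apply: norm_le_linear; rewrite ?invr_gt0 ?h0_gt0 //.
have d2 : 0 < delta D ^+ 2 by rewrite exprn_gt0.
rewrite /c mulrAC ler_pdivlMr // mulrC.
by apply: le_trans h; rewrite lerDr sqr_ge0.
Qed.

Lemma sublevel_omega_le U j0 j1 : CE_sublevel U ->
  `|omega (interp U) j0 j1| <= 1 * rho (interp U) j0 j1 + 2 * T / (4 * 1).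
Proof.
move=> [_ /(_ j0 j1)/fdelta_leW[r0 h]].
apply: norm_le_linear; rewrite ?mulr_ge0 //.
by apply: le_trans h; rewrite lerDl mulr_ge0 ?sqr_ge0.
Qed.

(* Summing the linear bound on zeta makes the mass satisfy
   M_{k+1} - M_k <= (M_k + M_{k+1}) / 2 + const. *)
Lemma mass_bounded k : bounded_on CE_sublevel (mass^~ k).
Proof.
elim/staggered_ind: k => [|j0 IH].
  apply: (@bounded_on_eq _ _ _ _ (fun=> \sum_(j1 < N1) rho_init D 0 j1)).
    by move=> U [[_ ri _ _ _] _]; apply: eq_bigr => j1 _; rewrite ri.
  exact: bounded_on_cst.
pose K := h0 D * \sum_(j1 < N1) (c / (4 * (h0 D)^-1)).
(* With [M] the old mass and [M'] the new one, [M' - M <= (M + M') / 2 + K] gives [M' <= 3 M + 2 K],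
   and [rho >= 0] gives [M' >= - M]. *)
apply: (@bounded_on_le _ _ _ _
  (fun U => 3 * `|mass U (sleft j0)| + 2 * K)); last first.
  apply: bounded_onD; last exact: bounded_on_cst.
  by apply: bounded_onZ; exact: bounded_on_abs.
move=> U SU; have [ceU _] := SU.
have lo : 0 <= 2^-1 * (mass U (sleft j0) + mass U (sright j0)).
  by rewrite -mass_interp sumr_ge0// => j1 _; exact: sublevel_rho_ge0.
have hi : mass U (sright j0) - mass U (sleft j0)
    <= 2^-1 * (mass U (sleft j0) + mass U (sright j0)) + K.
  rewrite mass_balance // -mass_interp /K.
  (* The sum of [rho] is rewritten as [h0 D] times its multiple by [(h0 D)^-1], so that [h0 D]
     cancels and the bound on [zetabar] applies term by term. *)
  rewrite -[X in _ <= X + _](mulVKf (lt0r_neq0 h0_gt0)) -mulrDr.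
  rewrite ler_pM2l ?h0_gt0 // mulr_sumr -big_split /= ler_sum // => j1 _.
  exact: le_trans (ler_norm _) (sublevel_zeta_le _ _ SU).
have K0 : 0 <= K.
  rewrite mulr_ge0 ?(ltW h0_gt0)// sumr_ge0 // => j1 _.
  by rewrite mulr_ge0 // invr_ge0 mulr_ge0 // invr_ge0 ltW // h0_gt0.
have m1 := ler_norm (mass U (sleft j0)).
have m2 := ler_norm (- mass U (sleft j0)); rewrite normrN in m2.
have := normr_ge0 (mass U (sleft j0)).
by rewrite ler_norml; move=> ?; apply/andP; split; lra.
Qed.

(** Entries are nonnegative, so each is at most its row sum, which is the average of two consecutive
    masses. *)
Lemma rho_bounded j0 j1 :
  bounded_on CE_sublevel (fun U => rho (interp U) j0 j1).
Proof.
apply: (@bounded_on_le _ _ _ _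
  (fun U => 2^-1 * (mass U (sleft j0) + mass U (sright j0)))); last first.
  by apply: bounded_onZ; apply: bounded_onD; exact: mass_bounded.
move=> U SU; rewrite -mass_interp ger0_norm ?sublevel_rho_ge0 //.
rewrite (bigD1 j1) //= lerDl sumr_ge0 // => k _; exact: sublevel_rho_ge0.
Qed.

Lemma zetabar_bounded j0 j1 : bounded_on CE_sublevel (fun U => zetabar U j0 j1).
Proof.
apply: bounded_on_le (fun U => @sublevel_zeta_le U j0 j1) _.
apply: bounded_onD; last exact: bounded_on_cst.
by apply: bounded_onZ; exact: rho_bounded.
Qed.

Lemma omega_bounded j0 j1 :
  bounded_on CE_sublevel (fun U => omega (interp U) j0 j1).
Proof.
apply: bounded_on_le (fun U => @sublevel_omega_le U j0 j1) _.
apply: bounded_onD; last exact: bounded_on_cst.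
by apply: bounded_onZ; exact: rho_bounded.
Qed.

(** Marching from the initial density: the right value of a cell is twice the average minus the left
    value. *)
Lemma rhobar_bounded k j1 : bounded_on CE_sublevel (fun U => rhobar U k j1).
Proof.
elim/staggered_ind: k => [|j0 IH].
  apply: (@bounded_on_eq _ _ _ _ (fun=> rho_init D 0 j1)).
    by move=> U [[_ ri _ _ _] _]; exact: ri.
  exact: bounded_on_cst.
apply: (@bounded_on_eq _ _ _ _
  (fun U => 2 * rho (interp U) j0 j1 + (-1) * rhobar U (sleft j0) j1)).
  by move=> U _; rewrite rho_interp; lra.
by apply: bounded_onD; apply: bounded_onZ => //; exact: rho_bounded.
Qed.

Lemma omegabar_bounded j0 k : bounded_on CE_sublevel (fun U => omegabar U j0 k).
Proof.
elim/staggered_ind: k => [|j1 IH].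
  apply: (@bounded_on_eq _ _ _ _ (fun=> 0)).
    by move=> U [[_ _ _ w0 _] _]; exact: w0.
  exact: bounded_on_cst.
apply: (@bounded_on_eq _ _ _ _
  (fun U => 2 * omega (interp U) j0 j1 + (-1) * omegabar U j0 (sleft j1))).
  by move=> U _; rewrite omega_interp; lra.
by apply: bounded_onD; apply: bounded_onZ => //; exact: omega_bounded.
Qed.

End Coercivity.

(** * Minimization of the cost *)

Section Objective.
Variables (R : realType) (N0 N1 d : nat) (D : wfr_data R N0 N1 d).
Hypotheses (hN0 : (0 < N0)%N) (hN1 : (0 < N1)%N) (hL : 0 < len D).

Let cell_gt0 : 0 < h0 D * h1 D.
Proof. by rewrite mulr_gt0 ?h0_gt0 ?h1_gt0. Qed.

Lemma cell_cost_ge0 r w z :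
  (0 <= fdelta (delta D) r w z * (h0 D * h1 D)%:E)%E.
Proof. by rewrite mule_ge0 ?fdelta_ge0 // lee_fin ltW. Qed.

Lemma J_ge0 V : (0 <= J D V)%E.
Proof.
by apply: sume_ge0 => j0 _; apply: sume_ge0 => j1 _; exact: cell_cost_ge0.
Qed.

Lemma J_le V (t : 'M[R]_(N0, N1)) :
  (forall j0 j1, (fdelta (delta D) (rho V j0 j1) (omega V j0 j1) (zeta V j0 j1)
                  <= (t j0 j1)%:E)%E) ->
  (J D V <= (\sum_(j0 < N0) \sum_(j1 < N1) h0 D * h1 D * t j0 j1)%:E)%E.
Proof.
move=> ft; rewrite -sumEFin; apply: lee_sum => j0 _.
rewrite -sumEFin; apply: lee_sum => j1 _.
by rewrite [leRHS]EFinM [leRHS]muleC lee_wpmul2r // lee_fin ltW.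
Qed.

(** A finite sum of extended reals is finite only if every term is. The cell costs themselves serve
    as [t], so the epigraph bound is tight and [J] is recovered exactly. *)
Lemma J_fin V : (J D V < +oo)%E ->
  exists t : 'M[R]_(N0, N1),
    (forall j0 j1, fdelta (delta D) (rho V j0 j1) (omega V j0 j1) (zeta V j0 j1)
                   = (t j0 j1)%:E) /\
    J D V = (\sum_(j0 < N0) \sum_(j1 < N1) h0 D * h1 D * t j0 j1)%:E.
Proof.
rewrite -ge0_fin_numE ?J_ge0 // => /sum_fin_numP Jfin.
pose f j0 j1 := fdelta (delta D) (rho V j0 j1) (omega V j0 j1) (zeta V j0 j1).
have ffin j0 j1 : f j0 j1 \is a fin_num.
  have /sum_fin_numP/(_ j1) := Jfin j0 (mem_index_enum _) isT.
  move=> /(_ (mem_index_enum _) isT); rewrite -/(f j0 j1).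
  rewrite !ge0_fin_numE ?cell_cost_ge0 ?fdelta_ge0 //.
  (* A cost [+oo] would stay [+oo] after multiplication by the positive cell area. *)
  case: (f j0 j1) => [r _|/=|//]; first exact: ltry.
  by rewrite gt0_mulye.
exists (\matrix_(j0, j1) fine (f j0 j1)).
have fE j0 j1 : f j0 j1 = ((\matrix_(j0, j1) fine (f j0 j1)) j0 j1)%:E.
  by rewrite mxE fineK.
split=> //; rewrite -sumEFin; apply: eq_bigr => j0 _.
rewrite -sumEFin; apply: eq_bigr => j1 _.
by rewrite -/(f j0 j1) fE [RHS]EFinM [RHS]muleC.
Qed.

Lemma cvx_indic_ge0 (X : Type) (S : set X) x : (0 <= cvx_indic R S x)%E.
Proof. by rewrite /cvx_indic; case: ifP. Qed.

Lemma cvx_indic_in (X : Type) (S : set X) x : S x -> cvx_indic R S x = 0%E.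
Proof. by move=> Sx; rewrite /cvx_indic asboolT. Qed.

Lemma cvx_indic_out (X : Type) (S : set X) x :
  ~ S x -> cvx_indic R S x = +oo%E.
Proof. by move=> Sx; rewrite /cvx_indic asboolF. Qed.

Lemma objective_feasible UV : feasible_set D UV -> objective D UV = J D UV.2.
Proof.
move=> [ce int bx _]; rewrite /objective !cvx_indic_in // big1 ?adde0 // => i _.
by rewrite cvx_indic_in.
Qed.

(** All terms are nonnegative, so no [-oo] can cancel a [+oo]: one violated constraint makes the
    whole objective [+oo]. *)
Lemma objective_lty UV : (objective D UV < +oo)%E -> feasible_set D UV.
Proof.
rewrite /objective => h.
have J0 := J_ge0 UV.2; have i1 := cvx_indic_ge0 (CE D) UV.1.
have i2 := cvx_indic_ge0
  [set UV' : Es R N0 N1 * Ec R N0 N1 | UV'.2 = interp UV'.1] UV.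
have i3 : (0 <= \sum_(i < d) cvx_indic R (box D i) UV.2)%E.
  by apply: sume_ge0 => i _; exact: cvx_indic_ge0.
have neqNy (x : \bar R) : (0 <= x)%E -> x != -oo%E by case: x.
split.
- apply: contrapT => e; move: h.
  by rewrite (cvx_indic_out e) addey ?neqNy // !addye ?neqNy.
- apply: contrapT => e; move: h.
  rewrite [X in (_ + X + _)%E]cvx_indic_out // addey ?neqNy ?adde_ge0 //.
  by rewrite addye ?neqNy.
- move=> i; apply: contrapT => e; move: h.
  have -> : (\sum_(i < d) cvx_indic R (box D i) UV.2 = +oo)%E.
    apply/esum_eqyP; first by move=> k _; rewrite neqNy ?cvx_indic_ge0.
    by exists i; rewrite mem_index_enum cvx_indic_out.
  by rewrite addey ?neqNy ?adde_ge0.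
- apply: le_lt_trans h; do 2 rewrite -addeA.
  by rewrite leeDl // !adde_ge0.
Qed.

(** The linear objective that replaces [J] in epigraph form: it dominates [J] at every point of the
    program and equals it when [t] is tight. *)
Definition cost_form : 'rV[R]_#|wfr_var N0 N1| :=
  \sum_(j0 < N0) \sum_(j1 < N1) (h0 D * h1 D) *: x_t R j0 j1.

Lemma cost_formE x : (cost_form *m x) 0 0
  = \sum_(j0 < N0) \sum_(j1 < N1) h0 D * h1 D * epi_of x j0 j1.
Proof.
rewrite form_sum; apply: eq_bigr => j0 _; rewrite form_sum.
by apply: eq_bigr => j1 _; rewrite formZ decodeE.
Qed.

Hypothesis hdelta : 0 < delta D.

Lemma socp_feasible x : socp_solution (wfr_socp D) x ->
  feasible_set D (staggered_of x, centered_of x) /\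
  (J D (centered_of x) <= ((cost_form *m x) 0 0)%:E)%E.
Proof.
move=> /(wfr_socpP _ hdelta)[ce int bx ft].
have Jx : (J D (centered_of x) <= ((cost_form *m x) 0 0)%:E)%E.
  by rewrite cost_formE; exact: J_le.
by split=> //; split=> //; exact: le_lt_trans Jx (ltry _).
Qed.

Lemma feasible_socp UV : feasible_set D UV ->
  exists2 x, socp_solution (wfr_socp D) x &
    J D UV.2 = ((cost_form *m x) 0 0)%:E.
Proof.
move=> [ce int bx /J_fin[t [ft Jt]]]; exists (encode UV.1 UV.2 t).
  apply/(wfr_socpP _ hdelta).
  by rewrite staggered_of_encode centered_of_encode epi_of_encode; split=> // *;
    rewrite ft.
by rewrite cost_formE epi_of_encode.
Qed.

(** The terms of [cost_form] are nonnegative, so a bound on their sum bounds each [t] by a common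
    [T]. The decoded [U] then lies in [CE_sublevel], and every coordinate is an entry of [U], of
    [interp U] or of [t]. *)
Lemma socp_sublevel_bounded (C : R) : exists K : R, forall x,
  socp_solution (wfr_socp D) x -> (cost_form *m x) 0 0 <= C ->
  forall i, `|x i 0| <= K.
Proof.
have [C0|C0] := leP 0 C; last first.
  (* For [C < 0] the sublevel set is empty, since [0 <= J <= cost_form]. *)
  exists 0 => x /socp_feasible[_ Jx] xC; have := le_lt_trans xC C0.
  by rewrite ltNge -lee_fin (le_trans (J_ge0 _) Jx).
pose T := C / (h0 D * h1 D).
have T0 : 0 <= T by rewrite divr_ge0 // ltW.
pose S := [set x : 'cV[R]_#|wfr_var N0 N1| |
  socp_solution (wfr_socp D) x /\ (cost_form *m x) 0 0 <= C].
have epi_ge0 x j0 j1 : S x -> 0 <= epi_of x j0 j1.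
  move=> [/(wfr_socpP _ hdelta)[_ _ _ /(_ j0 j1) ft] _].
  by rewrite -lee_fin (le_trans (fdelta_ge0 _ _ _ _) ft).
have epi_le x j0 j1 : S x -> epi_of x j0 j1 <= T.
  move=> Sx; have [_ xC] := Sx; rewrite ler_pdivlMr // mulrC.
  apply: le_trans xC; rewrite cost_formE (bigD1 j0) //= (bigD1 j1) //=.
  rewrite -addrA lerDl addr_ge0 // sumr_ge0 // => k _.
    by rewrite mulr_ge0 ?epi_ge0 // ltW.
  by rewrite sumr_ge0 // => l _; rewrite mulr_ge0 ?epi_ge0 // ltW.
have interpS x : S x -> centered_of x = interp (staggered_of x).
  by move=> [/(wfr_socpP _ hdelta)[]].
have zetaS x j0 j1 : S x ->
    zeta (centered_of x) j0 j1 = zetabar (staggered_of x) j0 j1.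
  by move=> Sx; rewrite interpS.
have sub x : S x -> CE_sublevel D T (staggered_of x).
  move=> Sx; have [/(wfr_socpP _ hdelta)[ce _ _ ft] _] := Sx.
  split=> // j0 j1; rewrite -zetaS // -interpS //.
  by apply: le_trans (ft j0 j1) _; rewrite lee_fin epi_le.
have lift (f : Es R N0 N1 -> R) : bounded_on (CE_sublevel D T) f ->
    bounded_on S (fun x => f (staggered_of x)).
  by move=> [K fK]; exists K => x Sx; exact/fK/sub.
(* One case per kind of variable, in the order of [wfr_var]; the entries of [V] are traded for those
   of [interp U]. *)
have entry v : bounded_on S (fun x => (read R v *m x) 0 0).
  case: v => [[[[[j0 j1]|[j0 j1]]|[j0 j1]]|[[[j0 j1]|[j0 j1]]|[j0 j1]]]|[j0 j1]].
  - refine (bounded_on_eq _ (lift _ (rhobar_bounded hN0 hdelta T0 j0 j1))).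
    by move=> x _; rewrite rhobarE.
  - refine (bounded_on_eq _ (lift _ (omegabar_bounded hN0 hdelta T0 j0 j1))).
    by move=> x _; rewrite omegabarE.
  - refine (bounded_on_eq _ (lift _ (zetabar_bounded hN0 hdelta T0 j0 j1))).
    by move=> x _; rewrite zetabarE.
  - refine (bounded_on_eq _ (lift _ (rho_bounded hN0 hdelta T0 j0 j1))).
    by move=> x Sx; rewrite -interpS // rhoE.
  - refine (bounded_on_eq _ (lift _ (omega_bounded hN0 hdelta T0 j0 j1))).
    by move=> x Sx; rewrite -interpS // omegaE.
  - refine (bounded_on_eq _ (lift _ (zetabar_bounded hN0 hdelta T0 j0 j1))).
    by move=> x Sx; rewrite -zetaS // zetaE.
  - exists T => x Sx; rewrite -[X in `|X|](epiE x j0 j1).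
    by rewrite ger0_norm ?epi_le ?epi_ge0.
have [K KS] := fin_all_exists entry.
(* Absolute values make all summands nonnegative, so the sum dominates each bound. *)
exists (\sum_v `|K v|) => x Px xC i.
have /(KS (enum_val i)) : S x by [].
rewrite read_mul enum_valK => /le_trans; apply.
rewrite (bigD1 (enum_val i)) //= (le_trans (ler_norm _)) // lerDl sumr_ge0 //.
Qed.

End Objective.

Theorem theorem4p1 (R : realType) (N0 N1 d : nat) (D : wfr_data R N0 N1 d)
    (hN0 : (0 < N0)%N) (hN1 : (0 < N1)%N)
    (hdelta : 0 < delta D) (hL : 0 < len D)
    (hbounds : forall (i : 'I_d) (j0 : 'I_N0),
        (box_lower D i j0 <= box_upper D i j0)%E) :
  ((exists UV : Es R N0 N1 * Ec R N0 N1, feasible_set D UV) ->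
   exists UV : Es R N0 N1 * Ec R N0 N1, is_minimizer (objective D) UV)
  /\
  (socp_solvable (wfr_socp D) <->
   exists UV : Es R N0 N1 * Ec R N0 N1, feasible_set D UV).
Proof.
split; last split.
- move=> [UV /(feasible_socp hN0 hN1 hL hdelta)[x0 Px0 _]].
  have [K Kbound] :=
    socp_sublevel_bounded hN0 hN1 hL hdelta ((cost_form D *m x0) 0 0).
  have [x Px xmin] := socp_min Px0 Kbound.
  have [feas Jx] := socp_feasible hN0 hN1 hL hdelta Px.
  exists (staggered_of x, centered_of x) => UV'.
  (* A competitor of infinite objective is trivial. A finite one is feasible and lifts to a point
     [y] whose linear cost equals its [J], so minimality of [x] applies. *)
  have [|UV'lty] := leP +oo%E (objective D UV').
    by rewrite leye_eq => /eqP ->; rewrite leey.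
  have feas' := objective_lty hN0 hN1 hL UV'lty.
  have [y Py Jy] := feasible_socp hN0 hN1 hL hdelta feas'.
  rewrite !objective_feasible // Jy; apply: le_trans Jx _.
  by rewrite lee_fin xmin.
- move=> [x /(socp_feasible hN0 hN1 hL hdelta)[feas _]].
  by exists (staggered_of x, centered_of x).
- by move=> [UV /(feasible_socp hN0 hN1 hL hdelta)[x Px _]]; exists x.
Qed.
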